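(* For every finite integer $n\ge1$, the variety $$\mathsf V(S_c^*(a^n))\vee\mathsf V(S_c^*(\{a_1\cdots a_m:m\ge1\}))$$ is finitely based.
   Context: An ai-semiring (additively idempotent semiring) is an algebra $(S,+,\cdot)$ with two binary operations such that $(S,+)$ is a commutative idempotent semigroup, $(S,\cdot)$ is a semigroup, and both distributive laws hold. The signature is $(+,\cdot)$, with no constants. $\mathsf V(S)$ denotes the variety generated by $S$, and $\vee$ is the join in the lattice of varieties. A variety is finitely based if its identities all follow from a finite set of them. For $n\ge 1$, $S_c^*(a^n)$ is the ai-semiring with universe $\{a,a^2,\ldots,a^n,0\}$ ($n+1$ distinct elements), where $0$ is absorbing for both addition and multiplication, $a^i+a^j=a^{\max\{i,j\}}$, and $a^i a^j=a^{i+j}$ if $i+j\le n$, $a^ia^j=0$ if $i+j>n$. Let $a_1,a_2,\ldots$ be distinct letters. The semiring $S_c^*(\{a_1\cdots a_m:m\ge1\})$ has as its nonzero elements all nonempty (finite) square-free commutative words on $\{a_1,a_2,\ldots\}$, together with an element $0$ absorbing for both addition and multiplication. For nonzero $u,v$: $u+v$ is the square-free word whose set of letters is the union of the sets of letters of $u$ and $v$; $u\cdot v$ is the square-free word $uv$ if $u$ and $v$ have no letter in common, and $u\cdot v=0$ otherwise. *)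

(* Defs.v *)
From Stdlib Require List.
From HB Require Import structures.
From mathcomp Require Import all_boot.
From mathcomp Require Import finmap zify.

Set Implicit Arguments.
Unset Strict Implicit.
Unset Printing Implicit Defensive.

(* Empty carriers are allowed. As the signature has no constants, the empty
   algebra satisfies every identity, so this convention affects neither the
   identities of a class nor their consequences. *)
Record algebra := Algebra {
  carrier :> Type;
  add : carrier -> carrier -> carrier;
  mul : carrier -> carrier -> carrier
}.

Record is_ai_semiring (A : algebra) : Prop := IsAiSemiring {
  ai_addA : associative (@add A);
  ai_addC : commutative (@add A);
  ai_addxx : idempotent_op (@add A);
  ai_mulA : associative (@mul A);
  ai_mulDl : left_distributive (@mul A) (@add A);
  ai_mulDr : right_distributive (@mul A) (@add A)
}.

Definition is_hom (A B : algebra) (f : A -> B) : Prop :=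
  {morph f : x y / add x y} /\ {morph f : x y / mul x y}.

Definition product (I : Type) (A : I -> algebra) : algebra :=
  @Algebra (forall i, A i)
    (fun x y i => add (x i) (y i)) (fun x y i => mul (x i) (y i)).

(* Subalgebras are taken up to isomorphism, as sources of injective
   homomorphisms. *)
Record is_variety (V : algebra -> Prop) : Prop := IsVariety {
  variety_H : forall (A B : algebra) (f : A -> B),
    is_hom f -> (forall b, exists a, f a = b) -> V A -> V B;
  variety_S : forall (A B : algebra) (f : A -> B),
    is_hom f -> injective f -> V B -> V A;
  variety_P : forall (I : Type) (A : I -> algebra),
    (forall i, V (A i)) -> V (product A)
}.

Definition variety_of (S : algebra) : algebra -> Prop :=
  fun A => forall V, is_variety V -> V S -> V A.

Definition variety_join (V W : algebra -> Prop) : algebra -> Prop :=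
  fun A => forall U, is_variety U ->
    (forall B, V B -> U B) -> (forall B, W B -> U B) -> U A.

Inductive term : Type :=
| Var of nat
| Add of term & term
| Mul of term & term.

Fixpoint eval (A : algebra) (v : nat -> A) (t : term) : A :=
  match t with
  | Var i => v i
  | Add s t => add (eval v s) (eval v t)
  | Mul s t => mul (eval v s) (eval v t)
  end.

Definition identity : Type := (term * term)%type.

Definition satisfies (A : algebra) (e : identity) : Prop :=
  forall v : nat -> A, eval v e.1 = eval v e.2.

Definition identity_of (V : algebra -> Prop) (e : identity) : Prop :=
  forall A, V A -> satisfies A e.

Definition follows_from (E : seq identity) (e : identity) : Prop :=
  forall A : algebra, (forall e', List.In e' E -> satisfies A e') ->
    satisfies A e.

Definition finitely_based (V : algebra -> Prop) : Prop :=
  exists E : seq identity,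
    (forall e, List.In e E -> identity_of V e) /\
    (forall e, identity_of V e -> follows_from E e).

(* The universe of S_c^*(a^n): [Some k] is the power a^k, and [None] is 0. *)
Definition power (n : nat) : Type := option {k : nat | 0 < k <= n}.

Definition power_add (n : nat) (x y : power n) : power n :=
  match x, y with
  | Some i, Some j => if val i <= val j then Some j else Some i
  | _, _ => None
  end.

(* [insub k] is [Some k] if 0 < k <= n and [None] otherwise. *)
Definition power_mul (n : nat) (x y : power n) : power n :=
  match x, y with
  | Some i, Some j => insub (val i + val j)
  | _, _ => None
  end.

Definition Sc_power (n : nat) : algebra :=
  Algebra (@power_add n) (@power_mul n).

Local Open Scope fset_scope.

(* A square-free commutative word is determined by its finite set of letters,
   the letter a_(i+1) being represented by i : nat. In [Sc_words], which is
   S_c^*({a_1 ... a_m : m >= 1}), [None] is 0. *)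
Definition sqfree_word : Type := {w : {fset nat} | w != fset0}.

Lemma fsetU_neq0 (u v : sqfree_word) : val u `|` val v != fset0.
Proof. by rewrite fsetU_eq0 negb_and (valP u). Qed.

Definition wordU (u v : sqfree_word) : sqfree_word :=
  exist _ (val u `|` val v) (fsetU_neq0 u v).

Definition word_add (x y : option sqfree_word) : option sqfree_word :=
  match x, y with
  | Some u, Some v => Some (wordU u v)
  | _, _ => None
  end.

Definition word_mul (x y : option sqfree_word) : option sqfree_word :=
  match x, y with
  | Some u, Some v => if [disjoint val u & val v]%fset then Some (wordU u v) else None
  | _, _ => None
  end.

Definition Sc_words : algebra := Algebra word_add word_mul.

(* Encoding 0 as n + 1 turns the operations of S_c^*(a^n) into max and addition
   truncated at n + 1. *)
Definition power_exp (n : nat) (x : power n) : nat :=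
  if x is Some k then val k else n.+1.

Lemma power_exp_inj n : injective (@power_exp n).
Proof.
move=> [i|] [j|] //= h.
- by congr Some; apply: val_inj.
- by have /andP[_] := valP i; rewrite /= h ltnn.
- by have /andP[_] := valP j; rewrite /= -h ltnn.
Qed.

Lemma power_exp_bounds n (x : power n) : 0 < power_exp x <= n.+1.
Proof.
by case: x => [i|] //=; have /andP[-> h] := valP i; exact: leqW.
Qed.

Lemma power_exp_add n (x y : power n) :
  power_exp (power_add x y) = maxn (power_exp x) (power_exp y).
Proof.
case: x y => [i|] [j|] //=; last by rewrite maxnn.
- by case: (leqP (val i) (val j)).
- by have /andP[_ h] := valP i; apply/esym/maxn_idPr/leqW.
- by have /andP[_ h] := valP j; apply/esym/maxn_idPl/leqW.
Qed.

Lemma power_exp_mul n (x y : power n) :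
  power_exp (power_mul x y) = minn (power_exp x + power_exp y) n.+1.
Proof.
case: x y => [i|] [j|] /=; try by lia.
have := valP i; have := valP j.
by case: insubP => [k /= hk ->|/=]; lia.
Qed.

Lemma Sc_power_ai n : is_ai_semiring (Sc_power n).
Proof.
split=> [x y z|x y|x|x y z|x y z|x y z] /=; apply: power_exp_inj;
  rewrite ?(power_exp_add, power_exp_mul).
- by rewrite maxnA.
- by rewrite maxnC.
- by rewrite maxnn.
- by have := power_exp_bounds x; have := power_exp_bounds z; lia.
- by lia.
- by lia.
Qed.

Lemma Sc_words_ai : is_ai_semiring Sc_words.
Proof.
split=> [[u|] [v|] [w|]|[u|] [v|]|[u|]|[u|] [v|] [w|]|[u|] [v|] [w|]
        |[u|] [v|] [w|]] //=; rewrite ?if_same //.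
- by congr Some; apply: val_inj; rewrite /= fsetUA.
- by congr Some; apply: val_inj; rewrite /= fsetUC.
- by congr Some; apply: val_inj; rewrite /= fsetUid.
- case Duv: [disjoint sval u & sval v]; case Dvw: [disjoint sval v & sval w];
    rewrite /= ?fdisjointUX ?fdisjointXU ?Duv ?Dvw ?andbF //= andbT.
  by case: ifP => // _; congr Some; apply: val_inj; rewrite /= fsetUA.
- by case: ifP.
- rewrite fdisjointUX; case: [disjoint sval u & sval w];
    case: [disjoint sval v & sval w] => //=.
  by congr Some; apply: val_inj; rewrite /= fsetUUl.
- by case: ifP.
- rewrite fdisjointXU; case: [disjoint sval u & sval v];
    case: [disjoint sval u & sval w] => //=.
  by congr Some; apply: val_inj; rewrite /= fsetUUr.
- by case: ifP.
Qed.

(* Main.v *)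
(* An identity holds in the join iff it holds in both generators, and it then
   amounts to inequalities v <= s, where v is a word and s a sum of words.
   - v <= s holds in S_c^*(a^n) iff for every weighting of the letters by
     1, ..., n + 1, some word of s weighs at least min(n + 1, weight of v).
   - v <= s holds in S_c^*({a_1 ... a_m : m >= 1}) iff s has a non-linear word, or
     v is linear and any two of its letters occur in a common word of s.
   If all words of s have length at most n, so has v; one word of s for each
   weighting of the letters of v, one for each pair of them and one non-linear
   word already witness v <= s, so v <= s follows from an identity of bounded size.
   If s has a word w of length > n, only the second condition matters, and four
   inequalities suffice: y <= xx + w, y <= xxp + w, x <= xp + w and
   xyz <= xy + xz + yz + w with w = w_1 ... w_(n+1); the last one, with a product
   substituted for z, builds a word from its pairs of letters by induction. *)

From Stdlib Require Import Classical ClassicalEpsilon FunctionalExtensionality.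
From HB Require Import structures.
From mathcomp Require Import all_boot finmap zify.
Require Import Defs.

Set Implicit Arguments.
Unset Strict Implicit.
Unset Printing Implicit Defensive.

(** * Finite sets of identities of bounded depth *)

Lemma term_comparable : comparable term.
Proof. by move=> s t; rewrite /decidable; decide equality; apply: eq_comparable. Qed.

HB.instance Definition _ := hasDecEq.Build term (compareP term_comparable).

Lemma In_mem (T : eqType) (x : T) (l : seq T) : List.In x l <-> x \in l.
Proof.
elim: l => [|y l IHl] //=; rewrite inE.
by split=> [[->|/IHl->]|/orP[/eqP->|/IHl]]; rewrite ?eqxx ?orbT; auto.
Qed.

(** No decision procedure for [P] is assumed: membership is settled by excluded middle at each
    entry. *)
Lemma seq_separation (T : eqType) (P : T -> Prop) (l : seq T) :
  exists l' : seq T, forall x, x \in l' <-> x \in l /\ P x.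
Proof.
elim: l => [|y l [l' IHl]]; first by exists [::] => x; split=> [|[]].
have [Py | nPy] := classic (P y).
- exists (y :: l') => x; rewrite !inE; split.
  + by case/orP=> [/eqP->|/IHl[-> ?]]; rewrite ?eqxx ?orbT.
  + by case=> /orP[->|hx Px] //; apply/orP; right; apply/IHl.
- exists l' => x; rewrite inE; split=> [/IHl[-> ?]|]; first by rewrite orbT.
  by case=> /orP[/eqP->|hx Px] //; apply/IHl.
Qed.

Fixpoint depth (t : term) : nat :=
  match t with
  | Var _ => 0
  | Add s t | Mul s t => (maxn (depth s) (depth t)).+1
  end.

Fixpoint vars (t : term) : seq nat :=
  match t with
  | Var i => [:: i]
  | Add s t | Mul s t => vars s ++ vars t
  end.

Fixpoint rename (f : nat -> nat) (t : term) : term :=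
  match t with
  | Var i => Var (f i)
  | Add s t => Add (rename f s) (rename f t)
  | Mul s t => Mul (rename f s) (rename f t)
  end.

Lemma eval_rename (A : algebra) (v : nat -> A) f t :
  eval v (rename f t) = eval (v \o f) t.
Proof. by elim: t => //= s -> t ->. Qed.

Lemma eq_in_eval (A : algebra) (v v' : nat -> A) t :
  {in vars t, v =1 v'} -> eval v t = eval v' t.
Proof.
elim: t => [i|s IHs t IHt|s IHs t IHt] /= h; first by apply: h; rewrite inE.
all: by rewrite IHs ?IHt // => x hx; apply: h; rewrite mem_cat hx ?orbT.
Qed.

Lemma size_vars t : size (vars t) <= 2 ^ depth t.
Proof.
elim: t => //= s IHs t IHt; rewrite size_cat expnS mul2n -addnn.
all: apply: leq_add; [apply: leq_trans IHs _|apply: leq_trans IHt _].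
all: by rewrite leq_exp2l // ?leq_maxl ?leq_maxr.
Qed.

Fixpoint terms (N d : nat) : seq term :=
  if d is d'.+1 then
    terms N d' ++ [seq Add s t | s <- terms N d', t <- terms N d']
               ++ [seq Mul s t | s <- terms N d', t <- terms N d']
  else [seq Var i | i <- iota 0 N].

Lemma mem_terms N d t :
  {in vars t, forall i, i < N} -> depth t <= d -> t \in terms N d.
Proof.
elim: d t => [|d IHd] [i|s t|s t] //= hN hd.
- by apply: map_f; rewrite mem_iota hN ?inE.
- by rewrite mem_cat IHd.
all: have /andP[hs ht] : (depth s <= d) && (depth t <= d) by rewrite -geq_max.
all: have hsN : {in vars s, forall i, i < N}
       by move=> i hi; apply: hN; rewrite mem_cat hi.
all: have htN : {in vars t, forall i, i < N}
       by move=> i hi; apply: hN; rewrite mem_cat hi orbT.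
all: rewrite !mem_cat; apply/or3P.
- by apply: Or32; apply: allpairs_f; apply: IHd.
- by apply: Or33; apply: allpairs_f; apply: IHd.
Qed.

(** A term of depth at most [d] has at most [2 ^ d] occurrences of variables, so up to renaming an
    identity of depth [d] lives on [2 ^ d + 2 ^ d] variables, and there are finitely many terms of
    bounded depth on these. *)
Lemma finite_basis_depth (P : identity -> Prop) d :
    (forall f e, P e -> P (rename f e.1, rename f e.2)) ->
  exists E : seq identity, (forall e, List.In e E -> P e) /\
    forall A : algebra, (forall e, List.In e E -> satisfies A e) ->
    forall e, P e -> depth e.1 <= d -> depth e.2 <= d -> satisfies A e.
Proof.
move=> Pr; set T := terms (2 ^ d + 2 ^ d) d.
have [E hE] := seq_separation P [seq (s, t) | s <- T, t <- T].
exists E; split=> [e /In_mem /hE[]//|A hA e Pe h1 h2 v].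
(* Each variable is renamed to its first position in [L]; [nth 0 L] undoes this on [L], so [v] can
   be recovered from a valuation of the renamed identity. *)
set L := vars e.1 ++ vars e.2; pose f := index^~ L.
have hL : size L <= 2 ^ d + 2 ^ d.
  by rewrite size_cat; apply: leq_add; apply: leq_trans (size_vars _) _;
     rewrite leq_exp2l.
have fK x : x \in L -> (nth 0 L \o f) x = x by move=> hx; apply: nth_index.
have hvars t : {subset vars t <= L} -> depth t <= d -> rename f t \in T.
  move=> ht hd; apply: mem_terms; last first.
    by rewrite [depth _](_ : _ = depth t) //; elim: (t) => //= ? -> ? ->.
  have -> : vars (rename f t) = map f (vars t).
    by elim: (t) => //= ? -> ? ->; rewrite map_cat.
  move=> _ /mapP[x /ht hx ->]; apply: leq_trans hL; rewrite /f index_mem //.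
have sub1 : {subset vars e.1 <= L} by move=> x hx; rewrite mem_cat hx.
have sub2 : {subset vars e.2 <= L} by move=> x hx; rewrite mem_cat hx orbT.
have hE' : List.In (rename f e.1, rename f e.2) E.
  by apply/In_mem/hE; split; [apply: allpairs_f; apply: hvars|apply: Pr].
have := hA _ hE' (v \o nth 0 L).
rewrite /= !eval_rename.
have fv t : {subset vars t <= L} -> eval ((v \o nth 0 L) \o f) t = eval v t.
  by move=> ht; apply: eq_in_eval => x /ht /fK /= ->.
by rewrite !fv.
Qed.

(** * Semirings as ordered sets, and terms as sums of words *)

(** In an ai-semiring this is the semilattice order whose join is addition; in both generators 0 is
    its greatest element. *)
Definition le (A : algebra) (x y : A) : Prop := add x y = y.

Section AiSemiring.

Context (A : algebra) (HA : is_ai_semiring A).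
Implicit Types x y z : A.

Lemma le_refl x : le x x.
Proof. exact: ai_addxx. Qed.

Lemma le_trans y x z : le x y -> le y z -> le x z.
Proof. by rewrite /le => hxy <-; rewrite (ai_addA HA) hxy. Qed.

Lemma le_anti x y : le x y -> le y x -> x = y.
Proof. by rewrite /le => hxy <-; rewrite (ai_addC HA). Qed.

Lemma le_addl x y : le x (add x y).
Proof. by rewrite /le (ai_addA HA) (ai_addxx HA). Qed.

Lemma le_addr x y : le y (add x y).
Proof. by rewrite (ai_addC HA); exact: le_addl. Qed.

Lemma add_lub x y z : le x z -> le y z -> le (add x y) z.
Proof. by rewrite /le -(ai_addA HA) => hx ->. Qed.

End AiSemiring.

(** The signature has no constants, so the empty word and the empty sum get the dummy term [Var 0];
    [words_ok] excludes both. *)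
Fixpoint word_term (w : seq nat) : term :=
  match w with
  | [::] => Var 0
  | [:: x] => Var x
  | x :: w' => Mul (Var x) (word_term w')
  end.

Fixpoint sum_term (s : seq (seq nat)) : term :=
  match s with
  | [::] => Var 0
  | [:: u] => word_term u
  | u :: s' => Add (word_term u) (sum_term s')
  end.

Notation weval v w := (eval v (word_term w)).
Notation seval v s := (eval v (sum_term s)).

Definition words_ok (s : seq (seq nat)) : bool := (s != [::]) && ([::] \notin s).

Fixpoint words (t : term) : seq (seq nat) :=
  match t with
  | Var i => [:: [:: i]]
  | Add s t => words s ++ words t
  | Mul s t => [seq u ++ w | u <- words s, w <- words t]
  end.

Lemma word_term_cons x w : w != [::] ->
  word_term (x :: w) = Mul (Var x) (word_term w).
Proof. by case: w. Qed.

Lemma vars_word_term w : w != [::] -> vars (word_term w) = w.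
Proof.
elim: w => // x w IHw _; have [->//|w0] := eqVneq w [::].
by rewrite word_term_cons //= IHw.
Qed.

Lemma sum_term_cons u s : s != [::] ->
  sum_term (u :: s) = Add (word_term u) (sum_term s).
Proof. by case: s. Qed.

Lemma depth_word_term w : depth (word_term w) <= size w.
Proof. by elim: w => [|x [|y w] IHw] //=; rewrite max0n. Qed.

Lemma depth_sum_term s m :
  {in s, forall u, size u <= m} -> depth (sum_term s) <= size s + m.
Proof.
elim: s => [|u s IHs] // hs; have hu : depth (word_term u) <= m.
  by apply: leq_trans (depth_word_term u) _; apply: hs; rewrite inE eqxx.
have /IHs {}IHs : {in s, forall u, size u <= m}.
  by move=> w hw; apply: hs; rewrite inE hw orbT.
have [->|s0] := eqVneq s [::]; first by rewrite /= (leq_trans hu) ?leq_addl.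
rewrite sum_term_cons //= addSn ltnS geq_max IHs andbT.
by rewrite (leq_trans hu) ?leq_addl.
Qed.

Lemma words_okP t : words_ok (words t).
Proof.
rewrite /words_ok; elim: t => [i|s IHs t IHt|s IHs t IHt] //=.
  move: IHs IHt; rewrite mem_cat negb_or.
  by by case: (words s) => //= u r -> /andP[_ ->].
move: IHs IHt; case: (words s) (words t) => [|u r] [|w q] //= hs _.
apply/negP=> /(@allpairsP _ _ _ cat (u :: r) (w :: q))[[a b] /= [ha _]].
by case: a ha hs => //= ->.
Qed.

Lemma weval_cons (A : algebra) (v : nat -> A) x w : w != [::] ->
  weval v (x :: w) = mul (v x) (weval v w).
Proof. by move=> w0; rewrite word_term_cons. Qed.

Lemma seval_cons (A : algebra) (v : nat -> A) u s : s != [::] ->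
  seval v (u :: s) = add (weval v u) (seval v s).
Proof. by move=> s0; rewrite sum_term_cons. Qed.

Section WordValues.

Context (A : algebra) (HA : is_ai_semiring A) (v : nat -> A).

Lemma weval_cat u w : u != [::] -> w != [::] ->
  weval v (u ++ w) = mul (weval v u) (weval v w).
Proof.
move=> + w0; elim: u => // x u IHu _.
have [->|u0] := eqVneq u [::]; first by rewrite cat1s word_term_cons.
rewrite cat_cons !word_term_cons //=; last by case: (u) u0.
by rewrite IHu // (ai_mulA HA).
Qed.

Lemma weval_rem x u : commutative (@mul A) -> x \in u -> rem x u != [::] ->
  weval v u = mul (v x) (weval v (rem x u)).
Proof.
move=> mulC; elim: u => // y u IHu; rewrite inE [rem _ _]/=.
have [<-|nxy] := eqVneq y x; first by move=> _ u0; rewrite word_term_cons.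
rewrite orFb => xu _.
have u0 : u != [::] by case: (u) xu.
rewrite word_term_cons //.
have [r0|r0] := eqVneq (rem x u) [::].
  have -> : u = [:: x].
    by apply: perm_small_eq => //; rewrite -r0; apply: perm_to_rem.
  by rewrite /= eqxx /= mulC.
rewrite word_term_cons //= IHu //.
by rewrite !(ai_mulA HA) (mulC (v y)).
Qed.

Lemma le_seval s u : u \in s -> le (weval v u) (seval v s).
Proof.
elim: s => // w s IHs; rewrite inE.
have [->|s0] := eqVneq s [::]; first by rewrite orbF => /eqP->; apply: le_refl.
rewrite sum_term_cons //= => /orP[/eqP->|/IHs hu]; first exact: le_addl.
by apply: le_trans hu _ => //; apply: le_addr.
Qed.

Lemma seval_lub s b : s != [::] -> {in s, forall u, le (weval v u) b} ->
  le (seval v s) b.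
Proof.
elim: s => // w s IHs _ hs.
have hw : le (weval v w) b by apply: hs; rewrite inE eqxx.
have [->//|s0] := eqVneq s [::]; rewrite sum_term_cons //=.
by apply: add_lub => //; apply: IHs => // u hu; apply: hs; rewrite inE hu orbT.
Qed.

Lemma seval_cat s t : s != [::] -> t != [::] ->
  seval v (s ++ t) = add (seval v s) (seval v t).
Proof.
move=> + t0; elim: s => // u s IHs _.
have [->|s0] := eqVneq s [::]; first by rewrite cat1s sum_term_cons.
rewrite cat_cons !sum_term_cons //=; last by case: (s) s0.
by rewrite IHs // (ai_addA HA).
Qed.

Lemma seval_map_cat u t : u != [::] -> words_ok t ->
  seval v (map (cat u) t) = mul (weval v u) (seval v t).
Proof.
move=> u0; elim: t => // w t IHt /andP[_]; rewrite inE negb_or eq_sym.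
case/andP=> w0 ht; have [->|t0] := eqVneq t [::]; first by rewrite /= weval_cat.
rewrite map_cons !sum_term_cons //=; last by case: (t) t0.
by rewrite weval_cat // IHt /words_ok ?t0 // (ai_mulDr HA).
Qed.

Lemma seval_allpairs s t : words_ok s -> words_ok t ->
  seval v [seq u ++ w | u <- s, w <- t] = mul (seval v s) (seval v t).
Proof.
move=> + t0; elim: s => // u s IHs /andP[_]; rewrite inE negb_or eq_sym.
case/andP=> u0 hs; have [->|s0] := eqVneq s [::].
  by rewrite /= cats0 seval_map_cat.
have tn0 : t != [::] by case/andP: t0.
rewrite sum_term_cons //= seval_cat.
- by rewrite seval_map_cat // IHs /words_ok ?s0 // (ai_mulDl HA).
- by case: (t) tn0.
- by case: (s) s0 (t) tn0 => // ? ? _ [].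
Qed.

(** Distributivity expands every term into a sum of words, which reduces identities to inequalities
    between a word and such a sum. *)
Lemma eval_words t : eval v t = seval v (words t).
Proof.
elim: t => //= s -> t ->.
  by rewrite seval_cat //; case/andP: (words_okP s); case/andP: (words_okP t).
by rewrite seval_allpairs ?words_okP.
Qed.

End WordValues.

(** * Inequalities between a word and a sum of words *)

(* Letters outside [v] may as well be given the least value 1, so only finitely
   many weights [phi] matter for a given [v]. *)
Definition dominates (n : nat) (s : seq (seq nat)) (v : seq nat) : Prop :=
  forall phi : nat -> nat, (forall x, 0 < phi x <= n.+1) ->
  exists2 u, u \in s & minn n.+1 (\sum_(x <- v) phi x) <= \sum_(x <- u) phi x.

(** The case [x = y] of the second alternative says that every letter of [v] occurs in [s]. *)
Definition links (s : seq (seq nat)) (v : seq nat) : Prop :=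
  (exists2 u, u \in s & ~~ uniq u) \/
  (uniq v /\ {in v &, forall x y, exists2 u, u \in s & (x \in u) && (y \in u)}).

Definition word_le (A : algebra) (v : seq nat) (s : seq (seq nat)) : Prop :=
  forall psi : nat -> A, le (weval psi v) (seval psi s).

(** * Inequalities in the semiring of powers of a *)

Section Powers.

Variable n : nat.

Lemma le_power (x y : Sc_power n) : le x y <-> power_exp x <= power_exp y.
Proof.
rewrite /le; split=> [<-|h]; first by rewrite power_exp_add leq_maxl.
by apply: power_exp_inj; rewrite power_exp_add; apply/maxn_idPr.
Qed.

Lemma weval_power (psi : nat -> Sc_power n) w : w != [::] ->
  power_exp (weval psi w) = minn n.+1 (\sum_(x <- w) power_exp (psi x)).
Proof.
elim: w => // x w IHw _; have [->|w0] := eqVneq w [::].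
  have /andP[_ hx] := power_exp_bounds (psi x).
  by rewrite big_seq1; apply/esym/minn_idPr.
rewrite weval_cons // big_cons power_exp_mul IHw //; lia.
Qed.

(** The order is linear here, so a finite join is attained by one of its terms. *)
Lemma seval_power (psi : nat -> Sc_power n) s : s != [::] ->
  exists2 u, u \in s & seval psi s = weval psi u.
Proof.
elim: s => // w s IHs _; have [->|s0] := eqVneq s [::].
  by exists w; rewrite ?mem_head.
have [u us hu] := IHs s0; rewrite sum_term_cons //= hu.
have [h|h] := leqP (power_exp (weval psi u)) (power_exp (weval psi w)).
- exists w; rewrite ?mem_head //.
  exact: etrans (ai_addC (Sc_power_ai n) _ _) (proj2 (le_power _ _) h).
- exists u; rewrite ?inE ?us ?orbT //.
  exact: (proj2 (le_power _ _) (ltnW h)).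
Qed.

Lemma dominatesP s v : words_ok s -> v != [::] ->
  word_le (Sc_power n) v s <-> dominates n s v.
Proof.
case/andP=> s0 hs v0; have sn u : u \in s -> u != [::].
  by apply: contraTneq => ->.
split=> [h phi hphi|h psi].
(* Weight [n.+1] falls outside the range of [insub] and gives 0, whose encoding is again [n.+1]; so
   every weighting comes from a valuation. *)
- pose psi x : Sc_power n := insub (phi x).
  have psiE x : power_exp (psi x) = phi x.
    by rewrite /psi; have := hphi x; case: insubP => [k /= _ ->|] //=; lia.
  have sumE w : \sum_(x <- w) power_exp (psi x) = \sum_(x <- w) phi x.
    exact: eq_bigr.
  have [u us hu] := seval_power psi s0; exists u => //.
  have := h psi; rewrite hu => /le_power.
  rewrite (weval_power psi v0) (weval_power psi (sn u us)) !sumE leq_min.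
  by case/andP.
- apply/le_power; rewrite weval_power //.
  have [|u us hu] := h (fun x => power_exp (psi x)).
    by move=> x; apply: power_exp_bounds.
  apply: leq_trans (_ : power_exp (weval psi u) <= _); last first.
    by apply/le_power/le_seval => //; apply: Sc_power_ai.
  by rewrite weval_power ?sn // leq_min geq_minl.
Qed.

End Powers.

(** [pairwise] compares entries at distinct positions, so irreflexivity forbids repetitions and
    symmetry removes the order of positions. *)
Lemma pairwise_symP (T : eqType) (r : rel T) (w : seq T) :
    symmetric r -> irreflexive r ->
  pairwise r w <-> uniq w /\ {in w &, forall x y, x != y -> r x y}.
Proof.
move=> rC rI; elim: w => [|x w IHw] //=; split.
- case/andP=> /allP hx /IHw[-> hw]; split.
    by rewrite andbT; apply/negP=> /hx; rewrite rI.
  move=> y z; rewrite !inE => /orP[/eqP->|yw] /orP[/eqP->|zw] nyz.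
  + by rewrite eqxx in nyz.
  + exact: hx.
  + by rewrite rC; apply: hx.
  + exact: hw.
- case=> /andP[xw uw] h; apply/andP; split.
    apply/allP=> y yw; apply: h; rewrite ?inE ?eqxx ?yw ?orbT //.
    by apply: contraNneq xw => ->.
  by apply/IHw; split=> // y z yw zw; apply: h; rewrite inE ?yw ?zw orbT.
Qed.

(** * Inequalities in the semiring of square-free words *)

Section SquareFreeWords.

Implicit Types x y z : Sc_words.

(** Disjointness extended to 0, which is coprime to nothing. This makes the relation irreflexive on
    all of [Sc_words]. *)
Definition coprime_words : rel Sc_words := fun x y => isSome (mul x y).

Lemma coprime_wordsC : symmetric coprime_words.
Proof.
by move=> [u|] [w|] //; rewrite /coprime_words /= fdisjoint_sym; case: ifP.
Qed.

Lemma coprime_wordsxx : irreflexive coprime_words.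
Proof.
move=> [[u u0]|] //; rewrite /coprime_words /= /fdisjoint fsetIid.
by rewrite (negPf u0).
Qed.

Lemma coprime_words_add x y : coprime_words x y -> mul x y = add x y.
Proof. by case: x y => [u|] [w|] //=; rewrite /coprime_words /=; case: ifP. Qed.

Lemma coprime_words_mul x y z :
  coprime_words x (mul y z) =
  [&& coprime_words y z, coprime_words x y & coprime_words x z].
Proof.
case: x y z => [x|] [y|] [z|]; rewrite /coprime_words //= ?andbF //.
by case: (boolP (fdisjoint (val y) (val z))) => //= _;
   rewrite fdisjointXU; do 2 case: fdisjoint.
Qed.

Lemma le_mull x y : le x (mul x y).
Proof.
case: x y => [x|] [y|] //; rewrite /le /=; case: ifP => //= _.
by congr Some; apply: val_inj; rewrite /= fsetUA fsetUid.
Qed.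

Lemma le_mulr x y : le y (mul x y).
Proof.
case: x y => [x|] [y|] //; rewrite /le /=; case: ifP => //= _.
by congr Some; apply: val_inj; rewrite /= fsetUCA fsetUid.
Qed.

Variable psi : nat -> Sc_words.

Lemma coprime_words_weval x w : w != [::] ->
  coprime_words x (weval psi w) =
  isSome (weval psi w) && all (fun i => coprime_words x (psi i)) w.
Proof.
elim: w => // i w IHw _; have [->|w0] := eqVneq w [::].
  rewrite /= andbT; case: (psi i) => [?|] //=.
  by case: (x).
rewrite weval_cons // coprime_words_mul -/(coprime_words _ _) !IHw //=.
by case: (weval psi w) => //; case: (psi i).
Qed.

Lemma isSome_weval w : w != [::] ->
  isSome (weval psi w) =
  all (isSome \o psi) w && pairwise (relpre psi coprime_words) w.
Proof.
elim: w => // i w IHw _; have [->|w0] := eqVneq w [::].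
  by rewrite /= !andbT.
rewrite weval_cons // -/(coprime_words _ _) coprime_words_weval // IHw //.
(* As [w] is nonempty, coprimality with one of its letters already forces [psi i] to be nonzero. *)
have hi : all (relpre psi coprime_words i) w -> isSome (psi i).
  by case: (w) w0 => // j r _ /andP[]; rewrite /= /coprime_words; case: (psi i).
rewrite /=; move: hi.
by case: (isSome (psi i)) (all _ w) (all _ w) (pairwise _ w) => [] [] [] [] // ->.
Qed.

Lemma le_weval i w : i \in w -> le (psi i) (weval psi w).
Proof.
elim: w => // j w IHw; rewrite inE; have [->|w0] := eqVneq w [::].
  by rewrite orbF => /eqP->; apply: (le_refl Sc_words_ai).
rewrite weval_cons // => /orP[/eqP->|/IHw hi]; first exact: le_mull.
by apply: (le_trans Sc_words_ai) hi _; apply: le_mulr.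
Qed.

(** A nonzero product in [Sc_words] coincides with the sum of its factors, hence is their join. *)
Lemma weval_lub w b : w != [::] -> isSome (weval psi w) ->
  {in w, forall i, le (psi i) b} -> le (weval psi w) b.
Proof.
elim: w => // i w IHw _; have [->|w0] := eqVneq w [::].
  by move=> _; apply; rewrite inE.
rewrite weval_cons // => hm h.
rewrite (coprime_words_add hm); apply: (add_lub Sc_words_ai).
  by apply: h; rewrite mem_head.
apply: IHw => // [|j hj]; last by apply: h; rewrite inE hj orbT.
by move: hm; rewrite -[isSome _]/(coprime_words _ _)
  coprime_words_weval // => /andP[].
Qed.

Lemma isSome_seval s : s != [::] ->
  isSome (seval psi s) = all (fun u => isSome (weval psi u)) s.
Proof.
elim: s => // u s IHs _; have [->|s0] := eqVneq s [::].
  by rewrite /= andbT.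
by rewrite seval_cons //= -IHs //; case: (weval psi u) (seval psi s) => [?|] [?|].
Qed.

End SquareFreeWords.

Lemma links_word_le s v : words_ok s -> v != [::] -> links s v ->
  word_le Sc_words v s.
Proof.
case/andP=> s0 hs v0 hl psi; have sn u : u \in s -> u != [::].
  by apply: contraTneq => ->.
(* If the sum is 0, it is the top element. Otherwise all words of [s] are nonzero, so they are
   linear and distinct letters sharing a word have disjoint values. *)
case hsv: (isSome (seval psi s)); last first.
  by case: (seval psi s) hsv => // _; rewrite /le /=; case: (weval psi v).
have rC : symmetric (relpre psi coprime_words).
  by move=> x y; apply: coprime_wordsC.
have rI : irreflexive (relpre psi coprime_words).
  by move=> x; apply: coprime_wordsxx.
move: hsv; rewrite isSome_seval // => /allP hsv.
have hu u : u \in s -> all (isSome \o psi) u /\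
    uniq u /\ {in u &, forall x y, x != y -> coprime_words (psi x) (psi y)}.
  move=> us; have := hsv u us; rewrite isSome_weval ?sn // => /andP[-> h].
  by split=> //; apply/(pairwise_symP u rC rI).
case: hl => [[u us /negP[]]|[uv hv]]; first by have [_ []] := hu u us.
apply: weval_lub => // [|x xv].
  rewrite isSome_weval //; apply/andP; split.
    apply/allP=> x xv; have [u us /andP[xu _]] := hv x x xv xv.
    by have [/allP/(_ x xu)] := hu u us.
  apply/(pairwise_symP v rC rI); split=> // x y xv yv.
  have [u us /andP[xu yu]] := hv x y xv yv.
  by have [_ [_]] := hu u us; apply.
have [u us /andP[xu _]] := hv x x xv xv.
by apply: (le_trans Sc_words_ai) (le_weval psi xu) _; apply: (le_seval Sc_words_ai).
Qed.

Lemma fset1_neq0 (i : nat) : [fset i]%fset != fset0.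
Proof. by apply/fset0Pn; exists i; rewrite inE. Qed.

Definition singleton (i : nat) : Sc_words :=
  Some (exist (fun w => w != fset0) [fset i]%fset (fset1_neq0 i)).

Lemma isSome_weval_singleton (f : nat -> nat) w : w != [::] ->
  isSome (weval (singleton \o f) w) = uniq (map f w).
Proof.
move=> w0; rewrite isSome_weval // all_predT uniq_pairwise pairwise_map.
apply: eq_pairwise => x y /=; rewrite /coprime_words /= fdisjointX1 inE eq_sym.
by case: eqP.
Qed.

(** Since 0 is the top, a valuation making [s] nonzero must make [v] nonzero. When all words of [s]
    are linear, valuations close to [singleton] keep [s] nonzero and would annihilate any [v]
    violating the second alternative. *)
Lemma word_le_links s v : words_ok s -> v != [::] -> word_le Sc_words v s ->
  links s v.
Proof.
case/andP=> s0 hs v0 h; have sn u : u \in s -> u != [::].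
  by apply: contraTneq => ->.
have hSome (psi : nat -> Sc_words) : isSome (seval psi s) -> isSome (weval psi v).
  by have := h psi; rewrite /le; case: (weval psi v) (seval psi s) => [?|] [?|].
have [|nl] := classic (exists2 u, u \in s & ~~ uniq u); [by left|right].
have su u : u \in s -> uniq u.
  by move=> us; case: (boolP (uniq u)) => // nu; case: nl; exists u.
have uv : uniq v.
  rewrite -[v]map_id -isSome_weval_singleton //; apply: hSome.
  rewrite isSome_seval //; apply/allP=> u us.
  by rewrite isSome_weval_singleton ?sn // map_id su.
split=> // x y xv yv.
have [/hasP[u us hu]|/hasPn hn] := boolP (has (fun u => (x \in u) && (y \in u)) s).
  by exists u.
have [eq_xy|nxy] := eqVneq x y.
  (* Give 0 to [x], which occurs in [v] only. *)
  pose psi i : Sc_words := if i == x then None else singleton i.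
  have : isSome (weval psi v) -> False.
    by rewrite isSome_weval // => /andP[/allP/(_ x xv)]; rewrite /= /psi eqxx.
  case; apply: hSome; rewrite isSome_seval //; apply/allP=> u us.
  rewrite (@eq_in_eval _ _ (singleton \o id)).
    by rewrite isSome_weval_singleton ?sn // map_id su.
  move=> i iu; rewrite /psi; case: eqP => // ix; case/negP: (hn u us).
  by rewrite -eq_xy andbb -ix -(vars_word_term (sn u us)).
(* Send [x] and [y] to the same letter. *)
pose f i := if i == y then x else i.
have : uniq (map f v) -> False.
  rewrite uniq_pairwise pairwise_map.
  have rC : symmetric (relpre f [rel i j | i != j]) by move=> i j; rewrite /= eq_sym.
  have rI : irreflexive (relpre f [rel i j | i != j]) by move=> i; rewrite /= eqxx.
  move/(pairwise_symP v rC rI) => [_ /(_ x y xv yv nxy)].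
  by rewrite /= /f (negPf nxy) !eqxx.
rewrite -isSome_weval_singleton //.
case; apply: hSome; rewrite isSome_seval //; apply/allP=> u us.
rewrite isSome_weval_singleton ?sn // map_inj_in_uniq ?su // => i j iu ju.
rewrite /f; case: eqP => [iy|_]; case: eqP => [jy|_] //.
- by rewrite iy jy.
- by move=> jx; case/negP: (hn u us); rewrite -iy iu jx ju.
- by move=> ix; case/negP: (hn u us); rewrite -jy ju -ix iu.
Qed.

(** * Deriving the inequalities *)

(** All weights are at least 1, so a word with more than [n] letters always reaches the truncation
    value [n.+1]. *)
Lemma dominates_long n s u v : u \in s -> n < size u -> dominates n s v.
Proof.
move=> us hu phi hphi; exists u => //; apply: leq_trans (geq_minl _ _) _.
apply: leq_trans hu _; rewrite -sum1_size; apply: leq_sum => x _.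
by case/andP: (hphi x).
Qed.

Lemma dominates_short n s v : {in s, forall u, size u <= n} -> dominates n s v ->
  size v <= n.
Proof.
(* Under the constant weight 1, weight is length. *)
move=> hs /(_ (fun=> 1))[] // u /hs hu; rewrite !sum1_size => h.
by lia.
Qed.

Lemma eq_weval (A : algebra) (psi v : nat -> A) u w : u != [::] ->
  map psi u = map v w -> weval psi u = weval v w.
Proof.
elim: u w => // x u IHu [|y w] //= _ [h1 h2].
have [u0|u0] := eqVneq u [::]; first by move: h2; rewrite u0; case: (w).
have w0 : w != [::] by move: h2; case: (w) => //; case: (u) u0.
by rewrite -/(word_term (x :: u)) -/(word_term (y :: w)) !weval_cons // h1 (IHu w).
Qed.

Lemma nonuniq_mem_rem (T : eqType) (u : seq T) : ~~ uniq u ->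
  exists2 x, x \in u & x \in rem x u.
Proof.
elim: u => // y u IHu /=; rewrite negb_and negbK.
have [yu _|_ /= /IHu[x xu xr]] := boolP (y \in u).
  by exists y; rewrite ?mem_head // eqxx.
exists x; first by rewrite inE xu orbT.
by case: ifP => // _; rewrite inE xr orbT.
Qed.

Section Derivations.

Variables (n K : nat) (A : algebra).
Hypothesis n_gt0 : 0 < n.
Hypothesis K_gt3 : 3 < K.
Hypothesis HA : is_ai_semiring A.
Hypothesis mulC : commutative (@mul A).
(** The inequalities that a finite basis can guarantee. The bound [n.+3] leaves room for a word of
    length [n.+1] and for words of three letters, and [K] for four words. *)
Hypothesis small_le : forall s v, words_ok s -> v != [::] ->
  dominates n s v -> links s v -> size s <= K ->
  {in v :: s, forall u, size u <= n.+3} -> word_le A v s.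

Section LongWord.

Variables (psi : nat -> A) (w : seq nat) (b : A).
Hypothesis w_long : n < size w.
Hypothesis w_le : le (weval psi w) b.

(* [iota 3 n.+1] is a generic word of length n + 1; its last letter takes the
   value of the rest of [w]. *)
Lemma long_word_value (x y z : A) : exists theta : nat -> A,
  [/\ theta 0 = x, theta 1 = y, theta 2 = z &
      weval theta (iota 3 n.+1) = weval psi w].
Proof.
exists (fun i => match i with 0 => x | 1 => y | 2 => z | k.+3 =>
  if k < n then psi (nth 0 w k) else weval psi (drop n w) end); split=> //.
rewrite -[n.+1]addn1 iotaD -[in RHS](cat_take_drop n w).
rewrite [in RHS]weval_cat //; first last.
- by rewrite -size_eq0 size_drop subn_eq0 -ltnNge.
- by rewrite -size_eq0 size_takel -?lt0n // ltnW.
rewrite weval_cat //; last by case: (n) n_gt0.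
congr (mul _ _); last by rewrite /= ltnn.
apply: eq_weval; first by case: (n) n_gt0.
rewrite -(map_nth_iota0 0) 1?ltnW // -map_comp -[3]/(3 + 0) iotaDl -map_comp.
by apply/eq_in_map => i; rewrite mem_iota /= => ->.
Qed.

(** The added word [iota 3 n.+1] makes domination automatic, so only [links] is left to check; its
    letters avoid 0, 1, 2, which are kept for the arguments. *)
Lemma small_le_long s v theta : v != [::] -> words_ok s ->
  links (iota 3 n.+1 :: s) v ->
  size s <= 3 -> {in v :: s, forall u, size u <= 3} ->
  weval theta (iota 3 n.+1) = weval psi w ->
  {in s, forall u, le (weval theta u) b} -> le (weval theta v) b.
Proof.
move=> v0 /andP[_ hs] hl s3 hs3 hw hb.
apply: (le_trans HA) (_ : le (seval theta (iota 3 n.+1 :: s)) b).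
  apply: small_le => //.
  - by apply: (dominates_long (u := iota 3 n.+1)); rewrite ?mem_head ?size_iota.
  - by apply: leq_trans K_gt3.
  move=> u; rewrite inE => /orP[uv|]; last rewrite inE => /orP[/eqP->|us].
  + by rewrite (leq_trans (hs3 u _)) // inE uv.
  + by rewrite size_iota ltnW.
  + by rewrite (leq_trans (hs3 u _)) // inE us orbT.
apply: seval_lub => // u; rewrite inE => /orP[/eqP->|/hb//].
by rewrite hw.
Qed.

(** A non-linear word satisfies [links] for every left side, even a fresh letter; hence [y] is
    arbitrary. *)
Lemma le_of_square (x y : A) : le (mul x x) b -> le y b.
Proof.
move=> h; have [theta [h0 h1 _ hw]] := long_word_value x y y; rewrite -h1.
apply: (small_le_long (s := [:: [:: 0; 0]]) (v := [:: 1])) hw _ => //.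
- by left; exists [:: 0; 0]; rewrite // !inE orbT.
- by move=> u; rewrite !inE => /orP[/eqP->|/eqP->].
- by move=> u; rewrite inE => /eqP->; rewrite /= h0.
Qed.

(** Without a unit, [p] cannot be specialised away, so the case with a cofactor is separate from
    that of the bare square. *)
Lemma le_of_square_mul (x p y : A) : le (mul x (mul x p)) b -> le y b.
Proof.
move=> h; have [theta [h0 h1 h2 hw]] := long_word_value x p y; rewrite -h2.
apply: (small_le_long (s := [:: [:: 0; 0; 1]]) (v := [:: 2])) hw _ => //.
- by left; exists [:: 0; 0; 1]; rewrite // !inE orbT.
- by move=> u; rewrite !inE => /orP[/eqP->|/eqP->].
- by move=> u; rewrite inE => /eqP->; rewrite /= h0 h1.
Qed.

Lemma le_of_mul (x p : A) : le (mul x p) b -> le x b.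
Proof.
move=> h; have [theta [h0 h1 _ hw]] := long_word_value x p p; rewrite -h0.
apply: (small_le_long (s := [:: [:: 0; 1]]) (v := [:: 0])) hw _ => //.
- right; split=> // i j; rewrite !inE => /eqP-> /eqP->.
  by exists [:: 0; 1]; rewrite // !inE orbT.
- by move=> u; rewrite !inE => /orP[/eqP->|/eqP->].
- by move=> u; rewrite inE => /eqP->; rewrite /= h0 h1.
Qed.

Lemma le_triangle (x y z : A) : le (mul x y) b -> le (mul x z) b ->
  le (mul y z) b -> le (mul x (mul y z)) b.
Proof.
move=> hxy hxz hyz; have [theta [h0 h1 h2 hw]] := long_word_value x y z.
rewrite -h0 -h1 -h2.
pose s := [:: [:: 0; 1]; [:: 0; 2]; [:: 1; 2]].
apply: (small_le_long (s := s) (v := [:: 0; 1; 2])) hw _ => //.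
- right; split=> // i j hi hj.
  have /hasP[u us hu] : has (fun u => (i \in u) && (j \in u)) s.
    by move: hi hj; rewrite !inE => /or3P[] /eqP-> /or3P[] /eqP->.
  by exists u; rewrite // inE us orbT.
- by move=> u; rewrite !inE => /or4P[] /eqP->.
- by move=> u; rewrite !inE => /or3P[] /eqP->; rewrite /= ?h0 ?h1 ?h2.
Qed.

(** Strong induction on length. For [x], [y] followed by a nonempty [t], the value of [t] is the
    third vertex of a triangle: the sides through [t] are shorter words, and the side [x y] is a
    hypothesis. *)
Lemma le_clique v : v != [::] -> uniq v ->
    {in v, forall x, le (psi x) b} ->
    {in v &, forall x y, x != y -> le (mul (psi x) (psi y)) b} ->
  le (weval psi v) b.
Proof.
have [m] := ubnP (size v); elim: m v => // m IHm [|x [|y [|z r]]] //.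
- by move=> _ _ _ h _; apply: h; rewrite inE.
- move=> _ _ uv _ h; apply: h; rewrite ?inE ?eqxx ?orbT //.
  by move: uv; rewrite /= inE => /andP[].
set t := z :: r; move=> hm _ uv h1 h2.
have hsub v' : subseq v' [:: x, y & t] -> size v' < m -> v' != [::] ->
    le (weval psi v') b.
  move=> hv' hs v0; apply: IHm => //; first exact: subseq_uniq uv.
    by move=> i /(mem_subseq hv'); apply: h1.
  by move=> i j /(mem_subseq hv') hi /(mem_subseq hv'); apply: h2.
have hxt : le (weval psi (x :: t)) b.
  by apply: hsub => //; apply: (@cat_subseq _ [:: x] t [:: x] (y :: t));
     rewrite ?subseq_cons.
have hyt : le (weval psi (y :: t)) b.
  by apply: hsub => //; apply: subseq_cons.
have t0 : t != [::] by [].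
rewrite (weval_cons psi x (w := y :: t)) // (weval_cons psi y t0).
apply: le_triangle; rewrite -?weval_cons //.
apply: h2; rewrite ?inE ?eqxx ?orbT //.
by move: uv; rewrite /= inE negb_or -andbA => /andP[].
Qed.

End LongWord.

Lemma word_le_long s v u : v != [::] -> u \in s -> n < size u ->
  links s v -> word_le A v s.
Proof.
move=> v0 us hu hl psi; have ub := le_seval HA psi us.
have hin w : w \in s -> le (weval psi w) (seval psi s) by apply: le_seval.
have wle x w : w \in s -> x \in w -> rem x w != [::] ->
    le (mul (psi x) (weval psi (rem x w))) (seval psi s).
  by move=> ws xw r0; rewrite -(weval_rem HA) //; apply: hin.
(* A repeated letter [x] is brought to the front twice by commutativity, leaving a square with or
   without a cofactor. *)
case: hl => [[w ws /nonuniq_mem_rem[x xw xr]]|[uv hv]].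
  have r0 : rem x w != [::] by case: (rem x w) xr.
  have := wle x w ws xw r0; have [r1|r1] := eqVneq (rem x (rem x w)) [::].
    have -> : rem x w = [:: x].
      by apply: perm_small_eq => //; rewrite -r1; apply: perm_to_rem.
    exact: le_of_square hu ub _ _.
  rewrite (weval_rem HA psi mulC xr r1).
  exact: (le_of_square_mul hu ub).
apply: (le_clique hu ub) => // [x xv|x y xv yv nxy].
  have [w ws /andP[xw _]] := hv x x xv xv.
  have [r0|r0] := eqVneq (rem x w) [::].
    have ew : w = [:: x].
      by apply: perm_small_eq => //; rewrite -r0; apply: perm_to_rem.
    by have := hin w ws; rewrite ew.
  exact: (le_of_mul hu ub) (wle x w ws xw r0).
have [w ws /andP[xw yw]] := hv x y xv yv.
have yr : y \in rem x w.
  have : y \in x :: rem x w by rewrite -(perm_mem (perm_to_rem xw)).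
  by rewrite inE eq_sym (negPf nxy).
have r0 : rem x w != [::] by case: (rem x w) yr.
have := wle x w ws xw r0; have [r1|r1] := eqVneq (rem y (rem x w)) [::].
  have -> // : rem x w = [:: y].
  by apply: perm_small_eq => //; rewrite -r1; apply: perm_to_rem.
(* All letters of [w] besides the chosen [x] and [y] form one cofactor, which [le_of_mul] drops. *)
rewrite (weval_rem HA psi mulC yr r1) (ai_mulA HA).
exact: (le_of_mul hu ub).
Qed.

End Derivations.

(** * Bounded families of words *)

(** Here n is [m.+1]. The summands index the weightings of the positions of [v], with values shifted
    down by 1, the pairs of positions, and the search for a non-linear word. *)
Definition witness_index (m : nat) : finType :=
  ({ffun 'I_m.+1 -> 'I_m.+2} + 'I_m.+1 * 'I_m.+1 + unit)%type.

Definition weight m (v : seq nat) (f : {ffun 'I_m.+1 -> 'I_m.+2}) (x : nat) : nat :=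
  if x \in v then (f (inord (index x v))).+1 else 1.

Definition witness_test m (v : seq nat) (i : witness_index m) (u : seq nat) : bool :=
  match i with
  | inl (inl f) =>
      minn m.+2 (\sum_(x <- v) weight v f x) <= \sum_(x <- u) weight v f x
  | inl (inr (j, k)) => (nth 0 v j \in u) && (nth 0 v k \in u)
  | inr _ => ~~ uniq u
  end.

Lemma bounded_witnesses m s v : words_ok s -> size v <= m.+1 ->
    dominates m.+1 s v -> links s v ->
  exists s' : seq (seq nat),
    [/\ {subset s' <= s}, words_ok s', size s' = #|witness_index m|,
        dominates m.+1 s' v & links s' v].
Proof.
case/andP=> s0 hs hv hd hl.
(* If no word passes the test, the default is the first word of [s], so [pick] never leaves [s]. *)
pose pick (i : witness_index m) := nth (head [::] s) s (find (witness_test v i) s).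
have pick_in i : pick i \in s.
  rewrite /pick; have [h|/hasPn h] := boolP (has (witness_test v i) s).
    by rewrite mem_nth // -has_find.
  by rewrite nth_default -?nth0 ?mem_nth ?lt0n ?size_eq0 // leqNgt -has_find;
     apply/hasPn.
have pickP i u : u \in s -> witness_test v i u -> witness_test v i (pick i).
  by move=> us hu; apply: nth_find; apply/hasP; exists u.
pose s' := map pick (enum (witness_index m)).
have mem_s' i : pick i \in s' by apply: map_f; rewrite mem_enum.
have sub : {subset s' <= s} by move=> u /mapP[i _ ->].
exists s'; split=> //.
- rewrite /words_ok (contra (sub [::]) hs) andbT.
  by apply: contraTneq (mem_s' (inr tt)) => ->.
- by rewrite size_map -cardE.
- move=> phi hphi.
  pose f := [ffun i : 'I_m.+1 => inord (phi (nth 0 v i)).-1 : 'I_m.+2].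
  have fE x : x \in v -> weight v f x = phi x.
    move=> xv; have hx : index x v < m.+1 by apply: leq_trans hv; rewrite index_mem.
    have /andP[h0 h1] := hphi x.
    by rewrite /weight xv ffunE (inordK hx) nth_index // inordK prednK.
  (* Off [v] the weight is the least possible, so a word heavy enough for [weight v f] is heavy
     enough for [phi]. *)
  have fle x : weight v f x <= phi x.
    have [/fE->//|xv] := boolP (x \in v).
    by rewrite /weight (negPf xv); case/andP: (hphi x).
  have [|u us hu] := hd (weight v f).
    by move=> x; rewrite /weight; case: ifP => // _; rewrite ltn_ord.
  exists (pick (inl (inl f))) => //.
  have /= := pickP (inl (inl f)) u us hu.
  rewrite (eq_big_seq phi fE) => /leq_trans; apply.
  by apply: leq_sum => x _; apply: fle.
- case: hl => [[u us nu]|[uv hl]]; [left|right; split=> // x y xv yv].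
    by exists (pick (inr tt)) => //; apply: (pickP (inr tt)) us nu.
  have hx : index x v < m.+1 by apply: leq_trans hv; rewrite index_mem.
  have hy : index y v < m.+1 by apply: leq_trans hv; rewrite index_mem.
  have [u us hu] := hl x y xv yv.
  pose i : witness_index m := inl (inr (Ordinal hx, Ordinal hy)).
  exists (pick i) => //; have := pickP i u us; rewrite /= !nth_index //.
  exact.
Qed.

Section SmallIdentities.

Variables (m K : nat) (A : algebra).
Hypothesis K_gt3 : 3 < K.
Hypothesis K_card : #|witness_index m| <= K.
Hypothesis HA : is_ai_semiring A.
Hypothesis mulC : commutative (@mul A).
Hypothesis small_le : forall s v, words_ok s -> v != [::] ->
  dominates m.+1 s v -> links s v -> size s <= K ->
  {in v :: s, forall u, size u <= m.+4} -> word_le A v s.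

Lemma word_le_of_small s v : words_ok s -> v != [::] ->
  dominates m.+1 s v -> links s v -> word_le A v s.
Proof.
move=> hs v0 hd hl.
have [/hasP[u us hu]|/hasPn hshort] := boolP (has (fun u => m.+1 < size u) s).
  exact: (word_le_long (n := m.+1) (K := K)) us hu hl.
have hs1 : {in s, forall u, size u <= m.+1} by move=> u /hshort; rewrite -leqNgt.
have hv1 := dominates_short hs1 hd.
have [s' [sub s'ok szs' hd' hl']] := bounded_witnesses hs hv1 hd hl.
move=> psi; apply: (le_trans HA) (_ : le (seval psi s') _).
  apply: small_le => //; first by rewrite szs'.
  move=> u hu; apply: (@leq_trans m.+1); last by rewrite -addn3 leq_addr.
  by move: hu; rewrite inE => /orP[/eqP->|/sub /hs1].
apply: seval_lub => //; first by case/andP: s'ok.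
by move=> u /sub us; apply: le_seval.
Qed.

End SmallIdentities.

(** * The finite basis *)

Definition comm_ai_axioms : seq identity :=
  let x := Var 0 in let y := Var 1 in let z := Var 2 in
  [:: (Add x (Add y z), Add (Add x y) z);
      (Add x y, Add y x);
      (Add x x, x);
      (Mul x (Mul y z), Mul (Mul x y) z);
      (Mul (Add x y) z, Add (Mul x z) (Mul y z));
      (Mul x (Add y z), Add (Mul x y) (Mul x z));
      (Mul x y, Mul y x)].

Lemma comm_ai_axiomsP (A : algebra) :
  (forall e, e \in comm_ai_axioms -> satisfies A e) <->
  is_ai_semiring A /\ commutative (@mul A).
Proof.
split=> [h|[[addA addC addxx mulA mulDl mulDr] mulC] e]; last first.
  by rewrite !inE => /or4P[|||/or4P[]] /eqP-> v /=.
have h' i (x y z : A) (hi : i < size comm_ai_axioms) :=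
  h _ (mem_nth (Var 0, Var 0) hi) (nth x [:: x; y; z]).
split; last by move=> x y; apply: (h' 6 x y x isT).
split=> [x y z|x y|x|x y z|x y z|x y z].
- exact: (h' 0 x y z isT).
- exact: (h' 1 x y x isT).
- exact: (h' 2 x x x isT).
- exact: (h' 3 x y z isT).
- exact: (h' 4 x y z isT).
- exact: (h' 5 x y z isT).
Qed.

Lemma Sc_power_mulC n : commutative (@mul (Sc_power n)).
Proof. by move=> x y; apply: power_exp_inj; rewrite !power_exp_mul addnC. Qed.

Lemma Sc_words_mulC : commutative (@mul Sc_words).
Proof.
move=> [u|] [w|] //=; rewrite fdisjoint_sym; case: ifP => // _.
by congr Some; apply: val_inj; rewrite /= fsetUC.
Qed.

Lemma satisfies_variety (e : identity) : is_variety (fun A => satisfies A e).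
Proof.
have hom (A B : algebra) (f : A -> B) (v : nat -> A) t : is_hom f ->
    eval (f \o v) t = f (eval v t).
  by case=> hD hM; elim: t => //= s -> t ->; rewrite ?hD ?hM.
split=> [A B f hf f_surj hA v|A B f hf f_inj hB v|I A hA v].
(* A choice of preimages lifts the valuation along the surjection. *)
- pose g b := sval (constructive_indefinite_description _ (f_surj b)).
  have gK b : f (g b) = b by rewrite /g; case: constructive_indefinite_description.
  have -> : v = f \o (g \o v) by apply: functional_extensionality => i /=.
  by rewrite !(hom _ _ f) // hA.
- by apply: f_inj; rewrite -!(hom _ _ f).
- apply: functional_extensionality_dep => i.
  have pr : is_hom (fun x : product A => x i) by [].
  have evalE t : eval v t i = eval (fun k => v k i) t := esym (hom _ _ _ v t pr).
  by rewrite !evalE; apply: hA.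
Qed.

(** The models of [e] form a variety, so they contain the join as soon as they contain both
    generators. *)
Lemma identity_of_join (A B : algebra) (e : identity) :
  identity_of (variety_join (variety_of A) (variety_of B)) e <->
  satisfies A e /\ satisfies B e.
Proof.
split=> [h|[hA hB] C]; last first.
  have he := satisfies_variety e.
  by move=> hC; apply: (hC (fun D => satisfies D e)) => // D hD; apply: (hD _ he).
by split; apply: h => U _ hA hB; [apply: hA | apply: hB] => V.
Qed.

Lemma satisfies_rename (A : algebra) (f : nat -> nat) e :
  satisfies A e -> satisfies A (rename f e.1, rename f e.2).
Proof. by move=> h v; rewrite /= !eval_rename. Qed.

Theorem theorem9p4 (n : nat) (hn : 1 <= n) :
  finitely_based (variety_join (variety_of (Sc_power n)) (variety_of Sc_words)).
Proof.
case: n hn => // m _; set S := Sc_power m.+1.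
pose P e := satisfies S e /\ satisfies Sc_words e.
(* One word per witness, and at least four for the triangle inequality with its long word. The depth
   bound that follows covers sums of [K.+1] words of length at most [m.+4]. *)
pose K := #|witness_index m| + 4.
have [|E [EP hE]] := @finite_basis_depth P (K.+1 + m.+4).
  by move=> f e [h1 h2]; split; apply: satisfies_rename.
exists E; split=> [e /EP /identity_of_join//|e /identity_of_join[eS eW] A /hE{}hE].
have hP e' : e' \in comm_ai_axioms -> P e'.
  by move=> he; split; apply: (proj2 (comm_ai_axiomsP _)) he; split;
    [exact: Sc_power_ai|exact: Sc_power_mulC|exact: Sc_words_ai|exact: Sc_words_mulC].
have [HA mulC] : is_ai_semiring A /\ commutative (@mul A).
  apply/comm_ai_axiomsP => e' he; apply: hE (hP _ he) _ _;
    by move: he; rewrite !inE => /or4P[|||/or4P[]] /eqP->; rewrite /= /K; lia.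
have small s v : words_ok s -> v != [::] -> dominates m.+1 s v -> links s v ->
    size s <= K -> {in v :: s, forall u, size u <= m.+4} -> word_le A v s.
  move=> hs v0 hd hl hK hsz psi; have s0 : s != [::] by case/andP: hs.
  (* The inequality between [v] and [s] is the identity v + s = s. *)
  have := hE (sum_term (v :: s), sum_term s) _ _ _ psi.
  rewrite seval_cons //; apply.
  - split=> theta; rewrite seval_cons //; last exact: links_word_le.
    exact: (proj2 (dominatesP m.+1 hs v0)).
  - by apply: leq_trans (depth_sum_term hsz) _; rewrite /= leq_add2r.
  - apply: leq_trans (depth_sum_term (m := m.+4) _) _; last by rewrite leq_add2r ltnW.
    by move=> u us; apply: hsz; rewrite inE us orbT.
have le_eval t1 t2 (psi : nat -> A) : P (t1, t2) -> le (eval psi t1) (eval psi t2).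
  move=> [h1 h2]; rewrite (eval_words HA psi t1) (eval_words HA psi t2).
  apply: seval_lub => //; first by case/andP: (words_okP t1).
  move=> v vt; have v0 : v != [::].
    by apply: contraTneq vt => ->; case/andP: (words_okP t1).
  (* In each generator [v] lies below [t1], which equals [t2] there. *)
  have hle B : is_ai_semiring B -> satisfies B (t1, t2) -> word_le B v (words t2).
    move=> HB hB theta; rewrite -(eval_words HB theta t2).
    by rewrite -(hB theta) (eval_words HB theta t1); apply: le_seval.
  apply: (word_le_of_small (K := K) _ _ HA mulC small) => //.
  - by rewrite /K; lia.
  - by rewrite /K; lia.
  - exact: words_okP.
  - by apply/dominatesP; [exact: words_okP | | apply: hle => //; exact: Sc_power_ai].
  - by apply: word_le_links; [exact: words_okP | |
      apply: hle => //; exact: Sc_words_ai].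
move=> psi; apply: (le_anti HA); apply: le_eval; first by case: e eS eW.
by split=> theta; [rewrite -eS|rewrite -eW].
Qed.
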